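(* Let $n\ge 0$ be an integer, let $c_0\in\mathbb{R}$, and let $p$ be the strict Laurent polynomial with integer coefficients such that $k_n(x)=p(x)e^{-x}$ for all real $x\neq 0$, where $k_n$ is the modified spherical Bessel function of the second kind. Let $x_{n,m}$ denote the $m$-th infsupum abscissa of $k_n$, and let $B$ be the set of all real branch numbers $b$ of $\mathrm{inverse}_b(k_n)$ for which the interval with endpoints $k_n(x_{n,b-1})$ and $k_n(x_{n,b})$ (the first endpoint included when it is attained in the branch, the second excluded) contains $c_0$. Then the set of all real solutions $x$ of the equation $$p(x)e^{-x}=c_0$$ is exactly $$\{\,\mathrm{inverse}_b(k_n)(c_0) : b\in B\,\}$$ (which is empty if $B$ is empty).
   Context: A strict univariate Laurent polynomial is either $0$ or a finite sum of terms, each a numeric coefficient times a negative integer power of the variable. Normalization of $k_n$: for integer $n\ge 0$ and real $x\neq 0$, $k_n(x)=(-x)^n\left(\frac1x\frac{d}{dx}\right)^n\frac{e^{-x}}{x}$ (no factor $\pi/2$). For example $k_0(x)=\frac1x e^{-x}$, $k_1(x)=\left(\frac1{x^2}+\frac1x\right)e^{-x}$, $k_2(x)=\left(\frac3{x^3}+\frac3{x^2}+\frac1x\right)e^{-x}$. Each $k_n$ is of the form $p(x)e^{-x}$ with $p$ a strict Laurent polynomial with integer coefficients. Infsupum abscissas and branches of a function $f$: the real $x$ where $f$ is defined are partitioned into maximal intervals on which $f$ is continuous and monotonic. The endpoints of these intervals (abscissas of local infima and suprema of $f$, including the pole at $x=0$, and $\pm\infty$ for unbounded intervals) are called the infsupum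 abscissas. They are numbered consecutively in increasing order by integers $m$, so that number $1$ is the least positive one (possibly $+\infty$), and those to its left are $0,-1,\dots$. For $k_n$, number $1$ is $+\infty$ and number $0$ is the pole $x=0$. Branch number $b$ is the interval $[x_{n,b-1},x_{n,b})$ (poles and infinite endpoints excluded). For $c$ in the image of branch interval $b$ under $f$, $\mathrm{inverse}_b(f)(c)$ denotes the unique $x$ in branch interval $b$ with $f(x)=c$. Endpoint values $f(x_{n,b-1})$ and $f(x_{n,b})$ are interpreted as one-sided limits from inside the branch interval, possibly $\pm\infty$. *)

(* Defs.v *)
From HB Require Import structures.
From mathcomp Require Import all_boot all_order all_algebra.
From mathcomp Require Import all_classical all_reals all_analysis.
Set Implicit Arguments.
Unset Strict Implicit.
Unset Printing Implicit Defensive.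
Import Order.TTheory GRing.Theory Num.Theory.
Import numFieldNormedType.Exports.
Local Open Scope classical_set_scope.
Local Open Scope ring_scope.

(* A strict Laurent polynomial is represented by its polynomial in the
   reciprocal variable: the coefficient of 'X^i is that of the (- i)-th power
   of the variable, so strictness means that the constant coefficient is 0. *)
Definition strict_laurent (A : nzRingType) (p : {poly A}) : Prop := p`_0 = 0.

Definition laurent_eval (R : realType) (p : {poly int}) (x : R) : R :=
  (map_poly intr p).[x^-1].

Section Bessel.
Variable R : realType.

Definition recip_derive (f : R -> R) : R -> R := fun x => x^-1 * derive1 f x.

(* Only meaningful for x != 0; normalized without the factor pi / 2. *)
Definition bessel_k (n : nat) (x : R) : R :=
  (- x) ^+ n * iter n recip_derive (fun y => expR (- y) / y) x.

Definition nonzero_reals : set R := [set x | x != 0].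

End Bessel.

(* A partial real function is given by a total f : R -> R together with its
   domain of definition D. *)
Section Branches.
Variables (R : realType) (D : set R) (f : R -> R).

Definition monotone_on (I : set R) : Prop :=
  {in I &, {homo f : x y / x <= y}} \/ {in I &, {homo f : x y /~ x <= y}}.

Definition monotone_interval (I : set R) : Prop :=
  [/\ I !=set0, is_interval I, I `<=` D,
      {within I, continuous f} & monotone_on I].

Definition max_monotone_interval (I : set R) : Prop :=
  monotone_interval I /\
  forall J : set R, monotone_interval J -> I `<=` J -> J = I.

Definition infsupum_abscissas : set (\bar R) :=
  [set e | exists2 I, max_monotone_interval I &
     e = ereal_inf (EFin @` I) \/ e = ereal_sup (EFin @` I)].

(* Consecutive numbering in increasing order, in which the least positive
   abscissa has number 1: a positive abscissa is numbered by how many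
   abscissas lie in ]0, e], and a nonpositive e has number 1 - k, where k is
   the number of abscissas in [e, 0]. *)
Definition has_number (m : int) (e : \bar R) : Prop :=
  infsupum_abscissas e /\
  exists k : nat,
    if (0 < e)%E then
      m = k%:Z /\
      ([set y | infsupum_abscissas y /\ (0 < y <= e)%E] #= `I_k)%card
    else
      m = 1 - k%:Z /\
      ([set y | infsupum_abscissas y /\ (e <= y <= 0)%E] #= `I_k)%card.

(* Only meaningful when an abscissa numbered m exists. *)
Definition infsupum_abscissa (m : int) : \bar R := get (has_number m).

Definition is_branch_number (b : int) : Prop :=
  (exists e, has_number (b - 1) e) /\ (exists e, has_number b e).

(* Intersecting with D removes a pole at the left endpoint. *)
Definition branch (b : int) : set R :=
  [set x | D x /\
     (infsupum_abscissa (b - 1) <= x%:E < infsupum_abscissa b)%E].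

(* Only meaningful when c is in the image of the branch. *)
Definition inverse_branch (b : int) (c : R) : R :=
  get [set x | unique (fun y => branch b y /\ f y = c) x].

(* The infinite value on the wrong side, +oo as a left endpoint here and -oo
   as a right endpoint below, never bounds a branch; the result is then a
   dummy. *)
Definition left_end_value (e : \bar R) : \bar R :=
  match e with
  | r%:E => lim ((f x)%:E @[x --> r^'+])
  | -oo%E => lim ((f x)%:E @[x --> -oo%R])
  | +oo%E => 0%E
  end.

Definition right_end_value (e : \bar R) : \bar R :=
  match e with
  | r%:E => lim ((f x)%:E @[x --> r^'-])
  | +oo%E => lim ((f x)%:E @[x --> +oo%R])
  | -oo%E => 0%E
  end.

Definition branch_value_interval (b : int) : set (\bar R) :=
  let u := left_end_value (infsupum_abscissa (b - 1)) in
  let v := right_end_value (infsupum_abscissa b) in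
  [set w | (Order.min u v < w < Order.max u v)%E \/
           w = u /\ exists2 x, branch b x & (f x)%:E = u].

Definition branch_numbers_of (c : R) : set int :=
  [set b | is_branch_number b /\ branch_value_interval b c%:E].

End Branches.

(* Main.v *)
Require Import Defs.
From HB Require Import structures.
From mathcomp Require Import all_boot all_order all_algebra finmap.
From mathcomp Require Import all_classical all_reals all_analysis.
From mathcomp Require Import ring lra zify.
Import Order.TTheory GRing.Theory Num.Theory.
Import numFieldNormedType.Exports.
Local Open Scope classical_set_scope.
Local Open Scope ring_scope.

Set Implicit Arguments.
Unset Strict Implicit.
Unset Printing Implicit Defensive.

(** The equation is solved branch by branch, and the statement holds for any
    function [f] on a domain [D] for which a finite set [Z] of points exists
    such that [f] is continuous on [D], and strictly monotone on every open
    interval that misses [Z], with every point outside [Z] in [D]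
    ([solutions_by_branches]).

    The maximal monotone interval that contains a given point is the union of
    all intervals through this point on which [f] is monotone in a fixed
    direction ([hull]): two such intervals can be glued at the common point.
    Since [f] is nowhere locally constant, the direction of a nondegenerate
    interval is unique, so that the union is indeed maximal
    ([max_interval_through]).  A maximal interval that meets a gap of [Z]
    contains it ([max_interval_gap]); hence the real abscissas lie in [Z], and
    there are finitely many of them.

    For a finite set of abscissas, the number of [e] is the count of the
    abscissas up to [e] minus the count of those up to 0 ([has_numberE]).
    The numbering is thus strictly increasing and without holes, and the
    branches are exactly the intervals between consecutive abscissas.  Every
    point of [D] is in one of them.

    Between consecutive abscissas [f] is strictly monotone, so its limits at
    the two ends are its infimum and supremum; both are unattained in the open
    interval, and every value strictly between them is taken by the
    intermediate value theorem.  A left endpoint in [D] adds its own value,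
    which by continuity is the limit there ([branch_values], [branch_inj]).

    It remains to see that [k_n] has this form with [Z] finite.  Functions
    [p(1/x) exp(-x)] are stable under differentiation, which acts on
    polynomials as [dlaurent], an injective operator.  By iteration [k_n] is
    not identically 0, so the polynomial [p] is not 0, so the derivative
    [dlaurent p] is not 0 either and has finitely many roots.  By Rolle's
    theorem [k_n] is injective, hence strictly monotone, on each interval
    without 0 or critical points ([laurent_exp_gap_mono]). *)

(** * Open intervals that miss a finite set *)

Definition misses (R : realType) (Z : seq R) (a b : R) : Prop :=
  forall z, z \in Z -> ~ (a < z < b).

Lemma gap_around (R : realType) (Z : seq R) (x : R) : x \notin Z ->
  exists a b, [/\ a < x, x < b & misses Z a b].
Proof.
elim: Z => [_|z Z IH]; first by exists (x - 1), (x + 1); split => //; lra.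
rewrite inE negb_or => /andP[xz /IH[a [b [ax xb Zab]]]].
have [zx|xz'|xz'] := ltgtP z x; last by rewrite xz' eqxx in xz.
- exists (Num.max a z), b; split => //; first by rewrite gt_max ax.
  move=> w; rewrite inE => /orP[/eqP->|/Zab wab]; rewrite gt_max.
    by rewrite ltxx andbF.
  by move=> /andP[/andP[aw _] wb]; apply: wab; rewrite aw.
- exists a, (Num.min b z); split => //; first by rewrite lt_min xb.
  move=> w; rewrite inE => /orP[/eqP->|/Zab wab]; rewrite lt_min.
    by rewrite ltxx !andbF.
  by move=> /andP[aw /andP[wb _]]; apply: wab; rewrite aw.
Qed.

(** At each point of [Z] that falls inside, the interval is cut, and its left
    part is kept. *)
Lemma gap_inside (R : realType) (Z : seq R) (x y : R) : x < y ->
  exists a b, [/\ x <= a, a < b, b <= y & misses Z a b].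
Proof.
move=> xy; elim: Z => [|z Z [a [b [xa ab by_ Zab]]]].
  by exists x, y; split.
have [/andP[az zb]|zab] := boolP (a < z < b).
  exists a, z; split => //; first exact: le_trans (ltW zb) by_.
  move=> w; rewrite inE => /orP[/eqP->|/Zab wab]; first by rewrite ltxx andbF.
  by move=> /andP[aw wz]; apply: wab; rewrite aw (lt_trans wz).
exists a, b; split => // w; rewrite inE => /orP[/eqP->|/Zab//].
exact/negP.
Qed.

Lemma notin_between (R : realType) (Z : seq R) (x y : R) : x < y ->
  exists2 w, x < w < y & w \notin Z.
Proof.
move=> /(gap_inside Z)[a [b [xa ab by_ Zab]]].
have amb : a < (a + b) / 2 < b by apply/andP; split; lra.
exists ((a + b) / 2); last by apply/negP => /Zab.
by case/andP: amb => am mb; rewrite (le_lt_trans xa am) (lt_le_trans mb by_).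
Qed.

(** * Monotonicity in a given direction *)

Section Directed.
Variable R : realType.
Implicit Types (f : R -> R) (I J : set R).

(** The order of the reals or its converse: a boolean direction lets one
    argument treat increasing and decreasing functions together. *)
Definition dle (s : bool) (u v : R) : bool := if s then u <= v else v <= u.

Lemma dle_refl s u : dle s u u. Proof. by case: s => /=. Qed.

Lemma dle_trans s u v w : dle s u v -> dle s v w -> dle s u w.
Proof. by case: s => /= [|uv vw]; [exact: le_trans|exact: le_trans uv]. Qed.

Lemma dle_anti s u v : dle s u v -> dle (~~ s) u v -> u = v.
Proof. by case: s => /= uv vu; apply/eqP; rewrite eq_le uv vu. Qed.

Definition directed (s : bool) f I : Prop :=
  forall x y, I x -> I y -> x <= y -> dle s (f x) (f y).

Lemma monotone_onP f I : monotone_on f I <-> exists s, directed s f I.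
Proof.
split=> [[mf|mf]|[[] mf]].
- by exists true => x y Ix Iy xy; apply: mf; rewrite ?inE.
- by exists false => x y Ix Iy xy; apply: mf; rewrite ?inE.
- by left=> x y /set_mem Ix /set_mem Iy xy; apply: mf.
- by right=> x y /set_mem Ix /set_mem Iy xy; apply: mf.
Qed.

Lemma directed_sub s f I J : I `<=` J -> directed s f J -> directed s f I.
Proof. by move=> IJ mJ x y /IJ Jx /IJ Jy; apply: mJ. Qed.

(** The union of all intervals through [y] on which [f] is monotone in the
    direction [s]; by gluing at [y] it is the largest of them. *)
Definition hull s D f y : set R :=
  [set x | exists J, [/\ is_interval J, J `<=` D, directed s f J, J y & J x]].

Lemma hull_interval s D f y : is_interval (hull s D f y).
Proof.
move=> x1 x2 [J1 [iJ1 JD1 m1 J1y J1x]] [J2 [iJ2 JD2 m2 J2y J2x]] z /andP[xz zx].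
have [zy|yz] := leP z y.
  by exists J1; split => //; apply: (iJ1 x1 y) => //; rewrite xz.
by exists J2; split => //; apply: (iJ2 y x2) => //; rewrite (ltW yz).
Qed.

Lemma hull_sub s D f y : hull s D f y `<=` D.
Proof. by move=> x [J [_ JD _ _ /JD]]. Qed.

(** Two points on opposite sides of [y] are compared through [y]; two points
    on the same side both lie in the member that contains the farther one. *)
Lemma hull_mono s D f y : directed s f (hull s D f y).
Proof.
move=> x1 x2 [J1 [iJ1 JD1 m1 J1y J1x]] [J2 [iJ2 JD2 m2 J2y J2x]] xx.
have [x2y|yx2] := leP x2 y.
  by apply: m1 => //; apply: (iJ1 x1 y) => //; rewrite xx.
have [x1y|yx1] := leP x1 y.
  by apply: (@dle_trans _ _ (f y)); [exact: m1|apply: m2 => //; exact: ltW].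
by apply: m2 => //; apply: (iJ2 y x2) => //; rewrite xx ltW.
Qed.

End Directed.

(** * Intervals between two abscissas *)

Section Between.
Variable R : realType.

Definition between (e1 e2 : \bar R) : set R := [set x | (e1 < x%:E < e2)%E].

Lemma between_interval e1 e2 : is_interval (between e1 e2).
Proof.
move=> x y /andP[ex _] /andP[_ ye] z /andP[xz zy]; apply/andP; split.
  by apply: lt_le_trans ex _; rewrite lee_fin.
by apply: le_lt_trans ye; rewrite lee_fin.
Qed.

Lemma between_two_points e1 e2 : (e1 < e2)%E ->
  exists x y, [/\ x < y, between e1 e2 x & between e1 e2 y].
Proof.
rewrite /between; move: e1 e2 => [r| |] [t| |] //=; rewrite ?lte_fin => rt.
- by exists ((2 * r + t) / 3), ((r + 2 * t) / 3); rewrite !lte_fin; split;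
    [lra|apply/andP; split; lra..].
- by exists (r + 1), (r + 2); rewrite !lte_fin !ltry; split;
    [lra|apply/andP; split => //; lra..].
- by exists (t - 2), (t - 1); rewrite !lte_fin !ltNyr; split;
    [lra|apply/andP; split => //; lra..].
- by exists 0, 1; rewrite !ltry !ltNyr.
Qed.

Definition consecutive (D : set R) (f : R -> R) (e1 e2 : \bar R) : Prop :=
  [/\ infsupum_abscissas D f e1, infsupum_abscissas D f e2, (e1 < e2)%E &
      forall e, infsupum_abscissas D f e -> ~ (e1 < e < e2)%E].

End Between.

(** * Numbering of the abscissas *)

(** Turns the cardinals in the definition of numbers into counts over a list,
    for which arithmetic is available. *)
Lemma card_eq_count (T : choiceType) (s : seq T) (P : pred T) (k : nat) :
  uniq s -> ([set y | y \in s /\ P y] #= `I_k)%card <-> count P s = k.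
Proof.
move=> us.
have -> : [set y | y \in s /\ P y] = [set` seq_fset tt [seq y <- s | P y]].
  apply/funext => y; apply/propext; rewrite /mkset /=.
  by rewrite (seq_fsetE tt) mem_filter andbC; split => /andP.
rewrite -(rwP card_eq_fsetP) size_seq_fset undup_id ?filter_uniq//.
by rewrite size_filter.
Qed.

(** An identity between numbers of elements follows from the same identity
    between indicator functions. *)
Lemma count_add (T : eqType) (s : seq T) (P Q P' Q' : pred T) :
  {in s, forall y, P y + Q y = P' y + Q' y}%N ->
  (count P s + count Q s = count P' s + count Q' s)%N.
Proof.
elim: s => //= y s IH h.
rewrite addnACA [RHS]addnACA h ?mem_head// IH// => z zs.
by rewrite h// inE zs orbT.
Qed.

Section Numbering.
Variables (R : realType) (D : set R) (f : R -> R) (s : seq (\bar R)).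
Hypothesis us : uniq s.
Hypothesis sE : infsupum_abscissas D f = [set` s].

Definition rank (e : \bar R) : nat := count (fun y => (y <= e)%E) s.

Lemma rank_pos e : (0 < e)%E ->
  (rank e = count (fun y => (0 < y <= e)%E) s + rank 0%E)%N.
Proof.
move=> e0; rewrite -[LHS]addn0 -[X in (_ + X = _)%N](count_pred0 s).
apply: count_add => y _ /=; rewrite addn0.
have [y0|y0] := leP y 0%E; first by rewrite (le_trans y0 (ltW e0)).
by rewrite /= addn0.
Qed.

Lemma rank_npos e : e \in s -> (e <= 0)%E ->
  (count (fun y => (e <= y <= 0)%E) s + rank e = rank 0%E + 1)%N.
Proof.
move=> es e0.
have <- : count_mem e s = 1%N by rewrite count_uniq_mem// es.
apply: count_add => y _ /=.
have [ye|ye|->] := ltgtP y e; last by rewrite e0.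
  by rewrite (le_trans (ltW ye) e0).
by rewrite /= !addn0.
Qed.

(** Both clauses of the numbering agree with one formula.  For a nonpositive
    [e] the abscissas in [[e, 0]] are those up to 0 except those below [e],
    and [e] itself accounts for the shift by 1. *)
Lemma has_numberE m e :
  has_number D f m e <-> e \in s /\ m = (rank e)%:Z - (rank 0%E)%:Z.
Proof.
rewrite /has_number sE; split=> -[es].
  move=> [k]; case: (ltP 0%E e) => e0 [-> /(card_eq_count _ _ us) <-].
    split => //; rewrite (rank_pos e0).
    by set a := count _ _; set b := rank _; lia.
  split => //; have := rank_npos es e0.
  by set a := count _ _; set b := rank 0%E; lia.
move=> ->; split => //; case: (ltP 0%E e) => e0.
  exists (count (fun y => (0 < y <= e)%E) s); split; last exact/card_eq_count.
  rewrite (rank_pos e0); set a := count _ _; set b := rank _; lia.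
exists (count (fun y => (e <= y <= 0)%E) s); split; last exact/card_eq_count.
have := rank_npos es e0; set a := count _ _; set b := rank 0%E; lia.
Qed.

Lemma rank_lt e1 e2 : e2 \in s -> (e1 < e2)%E -> (rank e1 < rank e2)%N.
Proof.
move=> e2s e12.
have h : (rank e1 + count (fun y => (e1 < y <= e2)%E) s =
          rank e2 + count pred0 s)%N.
  apply: count_add => y _ /=; rewrite addn0.
  by have [ye|ye] := leP y e1; first by rewrite (le_trans ye (ltW e12)).
have : has (fun y => (e1 < y <= e2)%E) s.
  by apply/hasP; exists e2; rewrite ?e12/=.
move: h; rewrite has_count count_pred0 addn0 => <- ?.
by rewrite -addn1 leq_add2l.
Qed.

Lemma rank_consecutive e1 e2 : consecutive D f e1 e2 ->
  rank e2 = (rank e1).+1.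
Proof.
rewrite /consecutive sE => -[e1s e2s e12 no].
have -> : (rank e1).+1 = (rank e1 + count_mem e2 s)%N.
  by rewrite count_uniq_mem// (e2s : e2 \in s) addn1.
rewrite -[LHS]addn0 -[X in (_ + X = _)%N](count_pred0 s).
apply: count_add => y ys /=; rewrite addn0.
have [ye|ye] := leP y e1.
  by rewrite (le_trans ye (ltW e12)) (lt_eqF (le_lt_trans ye e12)).
have [ye2|ye2|//] := ltgtP y e2; last by [].
by case: (no y ys); rewrite ye.
Qed.

Lemma has_number_uniq m e e' : has_number D f m e -> has_number D f m e' ->
  e = e'.
Proof.
move=> /has_numberE[es me] /has_numberE[es' me'].
by have [/(rank_lt es')|/(rank_lt es)|//] := ltgtP e e'; lia.
Qed.

Lemma infsupum_abscissaE m e : has_number D f m e ->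
  infsupum_abscissa D f m = e.
Proof.
move=> me; apply: has_number_uniq (me).
by apply: (@getPex _ (has_number D f m)); exists e.
Qed.

(** An abscissa strictly between the two ends would have a rank strictly
    between two successive integers. *)
Lemma branch_ends_consecutive b : is_branch_number D f b ->
  consecutive D f (infsupum_abscissa D f (b - 1)) (infsupum_abscissa D f b).
Proof.
move=> [[e1 h1] [e2 h2]].
rewrite !(infsupum_abscissaE h1, infsupum_abscissaE h2).
move: h1 h2 => /has_numberE[e1s b1] /has_numberE[e2s b2].
rewrite /consecutive sE; split => //.
  have [//|/(rank_lt e1s)|e12] := ltgtP e1 e2; first lia.
  by rewrite e12 in b1; lia.
move=> e es /andP[/(rank_lt es) h /(rank_lt e2s)]; lia.
Qed.

Lemma consecutive_branch e1 e2 : consecutive D f e1 e2 ->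
  exists b, [/\ is_branch_number D f b,
    infsupum_abscissa D f (b - 1) = e1 & infsupum_abscissa D f b = e2].
Proof.
move=> c; have r := rank_consecutive c.
have [+ + _ _] := c; rewrite sE => e1s e2s.
have h2 : has_number D f ((rank e2)%:Z - (rank 0%E)%:Z) e2 by apply/has_numberE.
have h1 : has_number D f ((rank e2)%:Z - (rank 0%E)%:Z - 1) e1.
  by apply/has_numberE; split => //; lia.
exists ((rank e2)%:Z - (rank 0%E)%:Z).
split; [split|exact: infsupum_abscissaE h1|exact: infsupum_abscissaE h2].
  by exists e1.
by exists e2.
Qed.

(** Finiteness gives a greatest abscissa up to [x] and a least one above. *)
Lemma consecutive_around x :
  (exists2 e, infsupum_abscissas D f e & (e <= x)%E) ->
  (exists2 e, infsupum_abscissas D f e & (x < e)%E) ->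
  exists e1 e2, consecutive D f e1 e2 /\ (e1 <= x < e2)%E.
Proof.
rewrite sE => -[l ls lx] [r rs xr].
pose lo := \big[Order.max/l]_(y <- s | (y <= x)%E) y.
pose hi := \big[Order.min/r]_(y <- s | (x < y)%E) y.
have [los lox] : lo \in s /\ (lo <= x)%E.
  rewrite /lo big_seq_cond.
  apply: (@big_ind _ (fun e => e \in s /\ (e <= x)%E)) => //.
    by move=> u v [us' ux] [vs vx]; rewrite /Order.max; case: ifP.
  by move=> i /andP[].
have [his hix] : hi \in s /\ (x < hi)%E.
  rewrite /hi big_seq_cond.
  apply: (@big_ind _ (fun e => e \in s /\ (x < e)%E)) => //.
    by move=> u v [us' ux] [vs vx]; rewrite /Order.min; case: ifP.
  by move=> i /andP[].
exists lo, hi; split; last by rewrite lox.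
rewrite /consecutive sE; split => //; first exact: le_lt_trans lox hix.
move=> e es /andP[le eh].
have [ex|xe] := leP e x.
  by move: le; rewrite ltNge => /negP; apply; exact: le_bigmax_seq.
by move: eh; rewrite ltNge => /negP; apply; exact: ge_bigmin_seq.
Qed.

End Numbering.

(** * One-sided limits of monotone functions *)

Section Limits.
Variable R : realType.
Implicit Types (f : R -> R) (I : set R) (s : bool).

(** The limit at the left end of a function that is monotone in the direction
    [s]; with [~~ s] it is the limit at the right end. *)
Definition extr s (A : set (\bar R)) : \bar R :=
  if s then ereal_inf A else ereal_sup A.

(** The filter stands for any one-sided neighbourhood, at a real point or at
    infinity: all that matters is that along it [f] is eventually at most each
    of its values on [I]. *)
Lemma cvg_inf (F : set_system R) (FF : ProperFilter F) f I : I !=set0 ->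
  (forall y, I y -> \forall x \near F, I x /\ f x <= f y) ->
  (f x)%:E @[x --> F] --> ereal_inf [set (f x)%:E | x in I].
Proof.
move=> [i Ii] near_le; set A := [set _ | _ in _].
have lb x : I x -> (ereal_inf A <= (f x)%:E)%E.
  by move=> Ix; apply: ereal_inf_lbound; exists x.
have near_lt c : (ereal_inf A < c)%E ->
    \forall x \near F, I x /\ ((f x)%:E < c)%E.
  move=> /ereal_inf_lt[_ [y Iy <-]] yc.
  apply: filterS (near_le y Iy) => x [Ix xy]; split => //.
  by apply: le_lt_trans yc; rewrite lee_fin.
case E : (ereal_inf A) => [r| |].
- apply: cvg_EFin; first by near=> x.
  apply/cvgrPdist_le => e e0.
  have : (ereal_inf A < (r + e)%:E)%E by rewrite E lte_fin; lra.
  move=> /near_lt; apply: filterS => x [/lb + +] /=.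
  by rewrite E lee_fin lte_fin => rx xr; rewrite ler_norml; lra.
- by have := lb i Ii; rewrite E leNgt ltry.
- apply/cvgeNyPle => M.
  have : (ereal_inf A < M%:E)%E by rewrite E ltNyr.
  by move=> /near_lt; apply: filterS => x [_ /ltW].
Unshelve. all: by end_near.
Qed.

Lemma cvg_extr s (F : set_system R) (FF : ProperFilter F) f I : I !=set0 ->
  (forall y, I y -> \forall x \near F, I x /\ dle s (f x) (f y)) ->
  (f x)%:E @[x --> F] --> extr s [set (f x)%:E | x in I].
Proof.
case: s => /= I0 h; first exact: cvg_inf.
have -> : (fun x => (f x)%:E) = (fun x => - (- f x)%:E)%E.
  by apply/funext => x; rewrite EFinN oppeK.
have -> : ereal_sup [set (- (- f x)%:E)%E | x in I] =
    (- ereal_inf [set (- f x)%:E | x in I])%E.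
  rewrite ereal_infEN oppeK; congr ereal_sup; rewrite image_comp.
  by [].
apply: cvgeN; apply: (@cvg_inf F FF (fun x => - f x)) => // y Iy.
by apply: filterS (h y Iy) => x [Ix xy]; rewrite lerN2.
Qed.

Lemma left_end_extr s f (e1 e2 : \bar R) : (e1 < e2)%E ->
  directed s f (between e1 e2) ->
  left_end_value f e1 = extr s [set (f x)%:E | x in between e1 e2].
Proof.
move=> e12 ms; have [i [_ [_ Ii _]]] := between_two_points e12.
have dir x y : between e1 e2 y -> (e1 < x%:E)%E -> x < y ->
    between e1 e2 x /\ dle s (f x) (f y).
  move=> by_ ex xy; have bx : between e1 e2 x.
    rewrite /between/= ex/=; case/andP: by_ => _; apply: lt_trans.
    by rewrite lte_fin.
  by split => //; apply: ms => //; exact: ltW.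
move: e1 e12 ms Ii dir => [r| |] e12 ms Ii dir //=.
- apply: cvg_lim => //; apply: cvg_extr; first by exists i.
  move=> y Iy; have ry : r < y by case/andP: (Iy); rewrite lte_fin.
  near=> x; apply: dir => //; rewrite ?lte_fin; near: x.
  exact: nbhs_right_gt.
- apply: cvg_lim => //; apply: cvg_extr; first by exists i.
  move=> y Iy.
  near=> x; apply: dir => //; rewrite ?ltNyr//; near: x.
  exact: nbhs_ninfty_lt (num_real y).
Unshelve. all: by end_near.
Qed.

Lemma right_end_extr s f (e1 e2 : \bar R) : (e1 < e2)%E ->
  directed s f (between e1 e2) ->
  right_end_value f e2 = extr (~~ s) [set (f x)%:E | x in between e1 e2].
Proof.
move=> e12 ms; have [i [_ [_ Ii _]]] := between_two_points e12.
have dir x y : between e1 e2 y -> (x%:E < e2)%E -> y < x ->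
    between e1 e2 x /\ dle (~~ s) (f x) (f y).
  move=> by_ xe yx; have bx : between e1 e2 x.
    rewrite /between/= xe andbT; case/andP: by_ => ey _; apply: lt_trans ey _.
    by rewrite lte_fin.
  by split => //; have := ms _ _ by_ bx (ltW yx); case: (s).
move: e2 e12 ms Ii dir => [r| |] e12 ms Ii dir //=.
- apply: cvg_lim => //; apply: cvg_extr; first by exists i.
  move=> y Iy; have ry : y < r by case/andP: (Iy) => _; rewrite lte_fin.
  near=> x; apply: dir => //; rewrite ?lte_fin; near: x.
  exact: nbhs_left_lt.
- apply: cvg_lim => //; apply: cvg_extr; first by exists i.
  move=> y Iy.
  near=> x; apply: dir => //; rewrite ?ltry//; near: x.
  exact: nbhs_pinfty_gt (num_real y).
- by move: e12; rewrite ltNge leNye.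
Unshelve. all: by end_near.
Qed.

Lemma left_end_continuous f r : {for r, continuous f} ->
  left_end_value f r%:E = (f r)%:E.
Proof.
move=> cf; apply: cvg_lim => //; apply: cvg_at_right_filter.
by apply: cvg_EFin; [near=> x|exact: cf].
Unshelve. all: by end_near.
Qed.

Lemma extr_min_max s (A : set (\bar R)) : A !=set0 ->
  Order.min (extr s A) (extr (~~ s) A) = ereal_inf A /\
  Order.max (extr s A) (extr (~~ s) A) = ereal_sup A.
Proof.
move=> [a Aa]; have h : (ereal_inf A <= ereal_sup A)%E.
  apply: (@le_trans _ _ a); first exact: ereal_inf_lbound.
  exact: ereal_sup_ubound.
by case: s => /=; [rewrite min_l ?max_r|rewrite min_r ?max_l].
Qed.

End Limits.

(** * Branches of a piecewise strictly monotone function *)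

Section Pieces.
Variables (R : realType) (D : set R) (f : R -> R) (Z : seq R).
Hypothesis ZD : forall x, x \notin Z -> D x.
Hypothesis Dcont : forall x, D x -> {for x, continuous f}.
Hypothesis gap_mono : forall a b, a < b -> misses Z a b ->
  monotone_on f (`]a, b[) /\ {in (`]a, b[) &, injective f}.

Lemma continuous_within I : I `<=` D -> {within I, continuous f}.
Proof.
by move=> ID; apply: continuous_in_subspaceT => x /set_mem /ID /Dcont.
Qed.

(** Inside any nondegenerate interval there is a gap of [Z], where [f] is
    injective; so [f] is nowhere locally constant. *)
Lemma directed_both s I x y : is_interval I ->
  directed s f I -> directed (~~ s) f I -> I x -> I y -> x < y -> False.
Proof.
move=> iI m1 m2 Ix Iy /(gap_inside Z)[a [b [xa ab by_ Zab]]].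
have [_ injf] := gap_mono ab Zab.
have IN z : z \in `]a, b[ -> I z.
  rewrite in_itv/= => /andP[az zb].
  by apply: (iI x y) => //; rewrite (le_trans xa (ltW az)) (le_trans (ltW zb)).
have u : (2 * a + b) / 3 \in `]a, b[.
  by rewrite in_itv/=; apply/andP; split; lra.
have v : (a + 2 * b) / 3 \in `]a, b[.
  by rewrite in_itv/=; apply/andP; split; lra.
have uv : (2 * a + b) / 3 <= (a + 2 * b) / 3 by lra.
have /(injf _ _ u v) := dle_anti
  (m1 _ _ (IN _ u) (IN _ v) uv) (m2 _ _ (IN _ u) (IN _ v) uv).
by lra.
Qed.

Lemma interval_oo (a b : R) : is_interval (`]a, b[ : set R).
Proof. exact: interval_is_interval. Qed.

Lemma hull_monotone s y : D y -> monotone_interval D f (hull s D f y).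
Proof.
move=> Dy; split.
- exists y, [set y]; split => //.
  - by move=> u v -> -> z; rewrite -eq_le => /eqP ->.
  - by move=> _ ->.
  - by move=> u v -> -> _; exact: dle_refl.
- exact: hull_interval.
- exact: hull_sub.
- by apply: continuous_within; exact: hull_sub.
- by apply/monotone_onP; exists s; exact: hull_mono.
Qed.

Lemma hull_ge s J y : is_interval J -> J `<=` D -> directed s f J -> J y ->
  J `<=` hull s D f y.
Proof. by move=> *; exists J. Qed.

Lemma misses_sub a b : misses Z a b -> `]a, b[ `<=` D.
Proof.
move=> Zab x; rewrite /= in_itv/= => xab; apply: ZD.
by apply/negP => /Zab.
Qed.

(** A larger interval in the opposite direction would make [f] constant on a
    gap, so the hull in the direction of the gap around [x] is maximal. *)
Lemma max_interval_through x : x \notin Z ->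
  exists2 I, max_monotone_interval D f I & I x.
Proof.
move=> xZ; have [a [b [ax xb Zab]]] := gap_around xZ.
have ab := lt_trans ax xb.
have [/monotone_onP[s ms] _] := gap_mono ab Zab.
have xab : [set` `]a, b[] x by rewrite /= in_itv/= ax.
have sub := hull_ge (@interval_oo a b) (misses_sub Zab) ms xab.
exists (hull s D f x); last exact: sub.
split; first exact/hull_monotone/ZD.
move=> K [_ iK KD _ /monotone_onP[s' mK]] hK.
have [ss'|/negPf ss'] := eqVneq s' s; last first.
  have {}mK : directed (~~ s) f K by move: mK; case: (s') (s) ss' => -[].
  have mab : [set` `]a, b[] ((x + b) / 2).
    by rewrite /= in_itv/=; apply/andP; split; lra.
  have xm : x < (x + b) / 2 by lra.
  by case: (directed_both (@interval_oo a b) ms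
    (directed_sub (subset_trans sub hK) mK) xab mab xm).
rewrite {s'}ss' in mK.
by apply/seteqP; split => //; apply: hull_ge => //; exact/hK/sub.
Qed.

(** If the directions agree, the gap can be glued to [I], which is already
    maximal.  If they disagree, [f] is constant on the intersection, so that
    [I] is a single point, on which both directions hold. *)
Lemma max_interval_gap I y a b : max_monotone_interval D f I -> I y ->
  misses Z a b -> a < y < b -> `]a, b[ `<=` I.
Proof.
move=> [[_ iI ID cI /monotone_onP[s' mI]] maxI] Iy Zab /andP[ay yb].
have ab := lt_trans ay yb.
have [/monotone_onP[s ms] _] := gap_mono ab Zab.
have yab : [set` `]a, b[] y by rewrite /= in_itv/= ay.
have glue t : directed t f I -> directed t f `]a, b[ -> `]a, b[ `<=` I.
  move=> tI tab; rewrite -(maxI (hull t D f y)).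
  - exact: hull_ge (@interval_oo a b) (misses_sub Zab) tab yab.
  - exact/hull_monotone/ID.
  - exact: hull_ge.
have [ss'|/negPf ss'] := eqVneq s' s.
  by apply: (glue s) => //; rewrite -ss'.
have {}mI : directed (~~ s) f I by move: mI; case: (s') (s) ss' => -[].
(* a single point is monotone in both directions *)
suff I1 z : I z -> z = y.
  by apply: (glue s) => // u v /I1 -> /I1 -> _; exact: dle_refl.
move=> Iz.
have both u v : u < v -> I u -> I v ->
    [set` `]a, b[] u -> [set` `]a, b[] v -> False.
  move=> uv Iu Iv ou ov; apply: (@directed_both s (I `&` `]a, b[) u v) => //.
  - move=> p q [Ip op] [Iq oq] r pr; split; first exact: iI pr.
    exact: interval_oo pr.
  - exact: directed_sub (@subIsetr _ _ _) ms.
  - exact: directed_sub (@subIsetl _ _ _) mI.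
have [zy|yz|//] := ltgtP z y; exfalso.
  pose w := Num.max z ((a + y) / 2).
  have /andP[zw wy] : z <= w < y by rewrite /w le_max gt_max lexx zy /=; lra.
  have aw : a < w by rewrite /w lt_max; apply/orP; right; lra.
  apply: (both w y) => //; first by apply: (iI z y) => //; rewrite zw ltW.
  by rewrite /= in_itv/= aw (lt_trans wy).
pose w := Num.min z ((y + b) / 2).
have /andP[yw wz] : y < w <= z by rewrite /w ge_min lt_min lexx yz /=; lra.
have wb : w < b by rewrite /w gt_min; apply/orP; right; lra.
apply: (both y w) => //; first by apply: (iI y z) => //; rewrite wz ltW.
by rewrite /= in_itv/= wb (lt_trans ay).
Qed.

Local Notation abscissas := (infsupum_abscissas D f).

(** Off [Z], an abscissa would lie strictly inside a gap that is contained in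
    the maximal interval it is supposed to bound. *)
Lemma real_abscissa_mem r : abscissas r%:E -> r \in Z.
Proof.
case=> I mI; apply: contraPT => rZ.
have [a [b [ar rb Zab]]] := gap_around rZ.
have H y m : I y -> a < y < b -> a < m < b -> I m.
  move=> Iy yab mab; apply: (max_interval_gap mI Iy Zab yab).
  by rewrite /= in_itv.
case=> re.
  have : (ereal_inf (EFin @` I) < b%:E)%E by rewrite -re lte_fin.
  move=> /ereal_inf_lt[_ [y Iy <-]]; rewrite lte_fin => yb.
  have ry : r <= y by rewrite -lee_fin re; apply: ereal_inf_lbound; exists y.
  have Im : I ((a + r) / 2).
    by apply: (H y) => //; apply/andP; split; lra.
  have : r <= (a + r) / 2.
    by rewrite -lee_fin re; apply: ereal_inf_lbound; exists ((a + r) / 2).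
  lra.
have : (a%:E < ereal_sup (EFin @` I))%E by rewrite -re lte_fin.
move=> /ereal_sup_gt[_ [y Iy <-]]; rewrite lte_fin => ay.
have yr : y <= r by rewrite -lee_fin re; apply: ereal_sup_ubound; exists y.
have Im : I ((r + b) / 2).
  by apply: (H y) => //; apply/andP; split; lra.
have : (r + b) / 2 <= r.
  by rewrite -lee_fin re; apply: ereal_sup_ubound; exists ((r + b) / 2).
lra.
Qed.

Lemma finite_abscissas : finite_set abscissas.
Proof.
apply: (@sub_finite_set _ _ [set` [:: -oo%E, +oo%E & map EFin Z]]).
  move=> [r| |] Ar /=; rewrite ?inE//.
  by rewrite map_f// real_abscissa_mem.
exact: finite_seq.
Qed.

Lemma abscissa_le (x : R) : exists2 e, abscissas e & (e <= x%:E)%E.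
Proof.
have [w /andP[_ wx] /max_interval_through[I mI Iw]] :
    exists2 w, x - 1 < w < x & w \notin Z.
  by apply: notin_between; lra.
exists (ereal_inf (EFin @` I)); first by exists I => //; left.
apply: (@le_trans _ _ w%:E); last by rewrite lee_fin ltW.
by apply: ereal_inf_lbound; exists w.
Qed.

Lemma abscissa_gt (x : R) : exists2 e, abscissas e & (x%:E < e)%E.
Proof.
have [w /andP[xw _] /max_interval_through[I mI Iw]] :
    exists2 w, x < w < x + 1 & w \notin Z.
  by apply: notin_between; lra.
exists (ereal_sup (EFin @` I)); first by exists I => //; right.
apply: (@lt_le_trans _ _ w%:E); first by rewrite lte_fin.
by apply: ereal_sup_ubound; exists w.
Qed.

(** The ends of the maximal interval through a point between [e1] and [e2] are
    abscissas, so they cannot lie strictly between [e1] and [e2]. *)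
Lemma consecutive_mono e1 e2 : consecutive D f e1 e2 ->
  between e1 e2 `<=` D /\ exists s, directed s f (between e1 e2).
Proof.
move=> [A1 A2 e12 no].
have [x [y [xy bx by_]]] := between_two_points e12.
have [w /andP[xw wy] /max_interval_through[I mI Iw]] := notin_between Z xy.
have /andP[ew we] : between e1 e2 w.
  by apply: (between_interval bx by_); rewrite !ltW.
have lo : (ereal_inf (EFin @` I) <= e1)%E.
  rewrite leNgt; apply/negP => h; apply: (no (ereal_inf (EFin @` I))).
    by exists I => //; left.
  rewrite h /=; apply: le_lt_trans we.
  by apply: ereal_inf_lbound; exists w.
have hi : (e2 <= ereal_sup (EFin @` I))%E.
  rewrite leNgt; apply/negP => h; apply: (no (ereal_sup (EFin @` I))).
    by exists I => //; right.
  rewrite h andbT; apply: lt_le_trans ew _.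
  by apply: ereal_sup_ubound; exists w.
case: mI => -[_ iI ID _ /monotone_onP[s ms]] _.
suff sub : between e1 e2 `<=` I.
  by split; [exact: subset_trans ID|exists s; exact: directed_sub ms].
move=> z /andP[ez ze].
have [_ [p Ip <-]] := ereal_inf_lt (le_lt_trans lo ez).
have [_ [q Iq <-]] := ereal_sup_gt (lt_le_trans ze hi).
by rewrite !lte_fin => zq pz; apply: (iI p q) => //; rewrite !ltW.
Qed.

(** Equal values at two points make a monotone function constant in between. *)
Lemma directed_inj s I x y : is_interval I -> directed s f I -> I x -> I y ->
  f x = f y -> x = y.
Proof.
move=> iI ms.
wlog xy : x y / x < y.
  move=> wl Ix Iy fxy; have [xy|yx|//] := ltgtP x y; first exact: wl.
  by apply/esym; exact: wl.
move=> Ix Iy fxy; exfalso; apply: (@directed_both s `[x, y] x y) => //.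
- exact: interval_is_interval.
- by apply: directed_sub ms => z; rewrite /= in_itv/=; exact: iI.
- have sub : `[x, y] `<=` I by move=> z; rewrite /= in_itv/=; exact: iI.
  have E z : [set` `[x, y]] z -> f z = f x.
    move=> xyz; have Iz := sub _ xyz.
    move: xyz; rewrite /= in_itv/= => /andP[xz zy].
    have := ms _ _ Ix Iz xz; have := ms _ _ Iz Iy zy; rewrite -fxy.
    by case: (s) => /= h1 h2; apply/eqP; rewrite eq_le h1 h2.
  by move=> u v /E -> /E -> _; exact: dle_refl.
- by rewrite /= in_itv/= lexx ltW.
- by rewrite /= in_itv/= lexx ltW.
Qed.

Section Cell.
Variables (e1 e2 : \bar R).
Hypothesis c12 : consecutive D f e1 e2.
Let u := left_end_value f e1.
Let v := right_end_value f e2.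

Lemma cell_ends : exists s, [/\ directed s f (between e1 e2),
  u = extr s [set (f x)%:E | x in between e1 e2],
  Order.min u v = ereal_inf [set (f x)%:E | x in between e1 e2] &
  Order.max u v = ereal_sup [set (f x)%:E | x in between e1 e2]].
Proof.
have [_ [s ms]] := consecutive_mono c12.
have [_ _ e12 _] := c12.
have [i [_ [_ Ii _]]] := between_two_points e12.
have A0 : [set (f x)%:E | x in between e1 e2] !=set0 by exists (f i)%:E, i.
have [mn mx] := extr_min_max s A0.
by exists s; rewrite /u /v (left_end_extr e12 ms) (right_end_extr e12 ms).
Qed.

Lemma cell_inj : {in between e1 e2 &, injective f}.
Proof.
have [s [ms _ _ _]] := cell_ends.
move=> x y /set_mem bx /set_mem by_.
exact: (directed_inj (@between_interval _ _ _) ms bx by_).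
Qed.

(** The bounds are strict because the interval is open: on each side of [x]
    there is a further point, whose value lies beyond [f x]. *)
Lemma cell_value x : between e1 e2 x ->
  (Order.min u v < (f x)%:E < Order.max u v)%E.
Proof.
move=> bx; have [s [ms _ -> ->]] := cell_ends.
have /andP[ex xe] := bx.
have [p [_ [_ /andP[ep px] _]]] := between_two_points ex.
have [q [_ [_ /andP[xq qe] _]]] := between_two_points xe.
have bp : between e1 e2 p by rewrite /between/= ep (lt_trans px).
have bq : between e1 e2 q by rewrite /between/= qe (lt_trans ex).
rewrite lte_fin in px; rewrite lte_fin in xq.
have pnx : f p != f x.
  apply: contraTneq px => /(cell_inj (mem_set bp) (mem_set bx)) ->.
  by rewrite ltxx.
have qnx : f q != f x.
  apply: contraTneq xq => /(cell_inj (mem_set bq) (mem_set bx)) ->.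
  by rewrite ltxx.
have below y : between e1 e2 y -> f y < f x ->
    (ereal_inf [set (f x)%:E | x in between e1 e2] < (f x)%:E)%E.
  move=> by_ yx; apply: (@le_lt_trans _ _ (f y)%:E); last by rewrite lte_fin.
  by apply: ereal_inf_lbound; exists y.
have above y : between e1 e2 y -> f x < f y ->
    ((f x)%:E < ereal_sup [set (f x)%:E | x in between e1 e2])%E.
  move=> by_ xy; apply: (@lt_le_trans _ _ (f y)%:E); first by rewrite lte_fin.
  by apply: ereal_sup_ubound; exists y.
have := ms _ _ bp bx (ltW px); have := ms _ _ bx bq (ltW xq).
case: (s) => /= xq' px'.
  by rewrite (below p) ?(above q)// lt_neqAle ?pnx // eq_sym qnx.
by rewrite (below q) ?(above p)// lt_neqAle ?qnx // eq_sym pnx.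
Qed.

Lemma cell_ivt (c : R) : (Order.min u v < c%:E < Order.max u v)%E ->
  exists2 x, between e1 e2 x & f x = c.
Proof.
have [s [ms _ -> ->]] := cell_ends.
move=> /andP[/ereal_inf_lt[_ [p bp <-]] pc /ereal_sup_gt[_ [q bq <-]] cq].
rewrite !lte_fin in pc cq.
have [bD _] := consecutive_mono c12.
have sub y : Num.min p q <= y <= Num.max p q -> between e1 e2 y.
  by apply: between_interval; rewrite /Order.min /Order.max; case: ifP.
have cont : {within `[Num.min p q, Num.max p q], continuous f}.
  apply: continuous_within => y; rewrite /= in_itv/= => /sub.
  exact: bD.
have pq : Num.min p q <= Num.max p q by rewrite ge_min le_max lexx.
have := IVT pq cont (v := c); case.
  rewrite ge_min le_max /Order.min /Order.max.
  by case: ifP => _; rewrite (ltW pc) (ltW cq) ?orbT.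
by move=> x; rewrite in_itv/= => /sub bx fx; exists x.
Qed.

Let B : set R := [set x | D x /\ (e1 <= x%:E < e2)%E].

Lemma branch_split x : B x -> between e1 e2 x \/ D x /\ e1 = x%:E.
Proof.
move=> [Dx /andP[]]; rewrite le_eqVlt => /orP[/eqP ->|ex xe]; first by right.
by left; rewrite /between/= ex.
Qed.

Lemma between_branch x : between e1 e2 x -> B x.
Proof.
move=> bx; split.
  by have [bD _] := consecutive_mono c12; exact: bD.
by case/andP: bx => /ltW -> ->.
Qed.

(** An attained left endpoint has the extreme value of the branch, which is
    not repeated in the interior. *)
Lemma branch_inj : {in B &, injective f}.
Proof.
have endpoint x y : e1 = x%:E -> D x -> between e1 e2 y -> f x <> f y.
  move=> ex Dx by_ fxy; have := cell_value by_; rewrite -fxy.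
  rewrite -(left_end_continuous (Dcont Dx)) -ex -/u.
  rewrite gt_min lt_max ltxx /= => /andP[vu uv].
  by have := lt_trans vu uv; rewrite ltxx.
move=> x y /set_mem/branch_split + /set_mem/branch_split.
move=> [bx [by_|[Dy ey]]|[Dx ex] [by_|[Dy ey]]] fxy.
- exact: (cell_inj (mem_set bx) (mem_set by_)).
- by case: (endpoint y x).
- by case: (endpoint x y).
- by move: ey; rewrite ex => -[].
Qed.

(** A left endpoint in the domain is the only place where the limit at the
    left end is attained. *)
Lemma branch_values (c : R) :
  ((Order.min u v < c%:E < Order.max u v)%E \/
    c%:E = u /\ exists2 x, B x & (f x)%:E = u) <->
  exists2 x, B x & f x = c.
Proof.
split=> [[/cell_ivt[x bx fx]|[<- [x Bx [fx]]]]|[x Bx <-]].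
- by exists x => //; exact: between_branch.
- by exists x.
- have [/cell_value|[Dx ex]] := branch_split Bx; first by left.
  right; rewrite /u ex left_end_continuous; last exact: Dcont.
  by split => //; exists x.
Qed.

End Cell.

(** Every solution lies in the branch between two consecutive abscissas around
    it.  There it is the only solution, and [c] is a value of the branch. *)
Theorem solutions_by_branches (c : R) :
  [set x | D x /\ f x = c] =
  [set inverse_branch D f b c | b in branch_numbers_of D f c].
Proof.
have [s us sE] : exists2 s : seq (\bar R),
    uniq s & infsupum_abscissas D f = [set` s].
  have /finite_seqP[s sE] := finite_abscissas.
  exists (undup s); first exact: undup_uniq.
  by rewrite sE; apply/seteqP; split => x /=; rewrite mem_undup.
have inverse b x : is_branch_number D f b -> branch D f b x -> f x = c ->
    inverse_branch D f b c = x.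
  move=> /(branch_ends_consecutive us sE) c12 Bx fx.
  have ux : unique (fun y => branch D f b y /\ f y = c) x.
    split=> // y [By fy]; apply: (branch_inj c12 (mem_set Bx) (mem_set By)).
    by rewrite fx fy.
  have [[Bz fz] _] : unique (fun y => branch D f b y /\ f y = c)
      (inverse_branch D f b c).
    by apply: (@getPex _ [set y | unique _ y]); exists x.
  by apply: (branch_inj c12 (mem_set Bz) (mem_set Bx)); rewrite fz fx.
apply/seteqP; split=> [x [Dx fx]|_ [b [nb vb] <-]] /=.
  have [e1 [e2 [c12 xe]]] := consecutive_around sE
    (abscissa_le x) (abscissa_gt x).
  have [b [nb E1 E2]] := consecutive_branch us sE c12.
  have Bx : branch D f b x by rewrite /branch/= E1 E2.
  exists b; last exact: inverse.
  split => //; rewrite /branch_value_interval/= E1 E2.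
  have [|h|[h [y By fy]]] := (branch_values c12 c).2; [by exists x|by left|].
  by right; split => //; exists y => //; rewrite /branch/= E1 E2.
have c12 := branch_ends_consecutive us sE nb.
have [x Bx fx] := (branch_values c12 c).1 vb.
rewrite (inverse b x nb Bx fx); split => //.
by case: Bx.
Qed.

End Pieces.

(** * Laurent polynomials times a decaying exponential *)

(** The action on [p] of differentiation of [p(1/x) exp(-x)]. *)
Definition dlaurent (A : nzRingType) (p : {poly A}) : {poly A} :=
  - ('X^2 * p^`() + p).

(** If the image is 0, the coefficients satisfy
    [p_(i+1) = - i p_i] with [p_0 = 0], so all of them vanish. *)
Lemma dlaurent_neq0 (A : nzRingType) (p : {poly A}) :
  p != 0 -> dlaurent p != 0.
Proof.
apply: contraNneq; rewrite /dlaurent => /eqP; rewrite oppr_eq0 => /eqP E.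
have {}E i : (if (i < 2)%N then 0 else p`_(i - 1) *+ (i - 1)) + p`_i = 0.
  have := congr1 (fun q : {poly A} => q`_i) E; rewrite coefD coefXnM coef0.
  case: i => [|[|i]] //=.
  by rewrite coef_deriv !subn1 subn2 /=.
apply/eqP/polyP => i; rewrite coef0.
elim: i => [|i IH]; first by have := E 0%N; rewrite add0r.
have := E i.+1; rewrite subn1/= IH mul0rn.
by case: ifP; rewrite add0r.
Qed.

Section Laurent.
Variable R : realType.
Implicit Types (p : {poly R}) (x : R).

Definition laurent_exp p x : R := p.[x^-1] * expR (- x).

Lemma is_derive_laurent_exp p x : x != 0 ->
  is_derive x (1 : R) (laurent_exp p) (laurent_exp (dlaurent p) x).
Proof.
move=> x0.
have dinv : is_derive x (1 : R) (fun y : R => y^-1) (- x ^- 2 *: (1 : R)).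
  exact: is_deriveV.
have dp := @is_derive1_comp _ (horner p) _ _ _ _ (is_derive_poly p x^-1) dinv.
have de : is_derive x (1 : R) (expR \o -%R) (expR (- x) * -1).
  exact: is_derive1_comp.
apply: is_derive_eq (is_deriveM dp de) _ => /=.
rewrite /laurent_exp /dlaurent !hornerE /= /GRing.scale /=.
rewrite exprVn; ring.
Qed.

Lemma continuous_laurent_exp p x :
  x != 0 -> {for x, continuous (laurent_exp p)}.
Proof.
move=> /(is_derive_laurent_exp p)[d _].
exact/differentiable_continuous/derivable1_diffP.
Qed.

(** Otherwise there would be lists of distinct roots of any length. *)
Lemma finitely_many_roots p : p != 0 ->
  exists Z : seq R, forall x, root p x -> x \in Z.
Proof.
move=> p0; apply: contrapT => noZ.
suff /(_ (size p)) [s [us /(max_poly_roots p0) h sp]] : forall k, exists s,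
    [/\ uniq s, all (root p) s & size s = k].
  by have := h us; rewrite sp ltnn.
elim=> [|k [s [us rs sk]]]; first by exists [::].
apply: contrapT => no; apply: noZ; exists s => x rx.
apply: contrapT => /negP xs; apply: no; exists (x :: s).
by split; rewrite /= ?xs ?us ?rx ?rs ?sk.
Qed.

Lemma near_neq0 x : x != 0 -> \forall y \near x, y != 0.
Proof. exact: (@cvgr_neq0 _ _ _ (nbhs x) _ id x cvg_id). Qed.

(** A zero of the derivative at [x] is a root [1/x] of [dlaurent p]; without
    one, Rolle's theorem makes the function injective, and a continuous
    injective function on an interval is strictly monotone. *)
Lemma laurent_exp_gap_mono p (Z : seq R) a b : a < b ->
  (forall x, x != 0 -> root (dlaurent p) x^-1 -> x \in Z) ->
  misses (0 :: Z) a b ->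
  monotone_on (laurent_exp p) (`]a, b[) /\
  {in (`]a, b[) &, injective (laurent_exp p)}.
Proof.
move=> ab rootZ Zab.
have x0 x : x \in `]a, b[ -> x != 0.
  rewrite in_itv/= => xab; apply: contraPneq (xab) => ->.
  by apply: Zab; rewrite mem_head.
have cont : {within `]a, b[, continuous (laurent_exp p)}.
  apply: continuous_in_subspaceT => x /set_mem /= /x0.
  exact: continuous_laurent_exp.
have inj : {in (`]a, b[) &, injective (laurent_exp p)}.
  move=> x y.
  wlog xy : x y / x < y.
    move=> wl xab yab E; have [xy|yx|//] := ltgtP x y; first exact: wl.
    by apply/esym/wl.
  move=> xab yab E; exfalso.
  have sub z : z \in `[x, y] -> z \in `]a, b[.
    move: xab yab; rewrite !in_itv/= => /andP[ax _] /andP[_ yb] /andP[xz zy].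
    by rewrite (lt_le_trans ax) ?(le_lt_trans zy).
  have [z zxy [_ Dz0]] : exists2 z, z \in `]x, y[ &
      is_derive z (1 : R) (laurent_exp p) 0.
    apply: Rolle => //.
      by move=> z /subset_itv_oo_cc/sub/x0/(is_derive_laurent_exp p)[].
    apply: continuous_in_subspaceT => z /set_mem /sub/x0.
    exact: continuous_laurent_exp.
  have zab := sub z (subset_itv_oo_cc zxy).
  have [_] := is_derive_laurent_exp p (x0 z zab).
  rewrite Dz0 => /esym/eqP; rewrite mulf_eq0 (gt_eqF (expR_gt0 _)) orbF => rz.
  apply: (Zab z); last by move: zab; rewrite in_itv.
  by rewrite inE (rootZ z (x0 z zab) rz) orbT.
split => //.
have [h|h] := itv_continuous_inj_mono cont inj.
  left=> x y /set_mem/= xab /set_mem/= yab.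
  by rewrite le_eqVlt => /orP[/eqP->//|xy]; apply/ltW/h.
right=> x y /set_mem/= xab /set_mem/= yab.
by rewrite le_eqVlt => /orP[/eqP->//|xy]; apply/ltW/h.
Qed.

Lemma laurent_exp_eq0 p : (forall x, x != 0 -> laurent_exp p x = 0) -> p = 0.
Proof.
move=> h; apply/eqP; apply: contrapT => /negP/finitely_many_roots[Z rZ].
have [w _] := @notin_between R (0 :: Z) 0 1 ltr01.
rewrite inE negb_or => /andP[w0 /negP]; apply; apply: rZ.
have /eqP := h w^-1 (invr_neq0 w0).
by rewrite mulf_eq0 (gt_eqF (expR_gt0 _)) orbF invrK.
Qed.

(** The factor [1/x] multiplies the polynomial by ['X], so each step keeps it
    nonzero. *)
Lemma iter_recip_derive n : exists2 p : {poly R}, p != 0 &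
  forall x, x != 0 ->
  iter n (@recip_derive R) (fun y => expR (- y) / y) x = laurent_exp p x.
Proof.
elim: n => [|n [p p0 IH]].
  exists 'X; first by rewrite polyX_eq0.
  by move=> x x0; rewrite /= /laurent_exp hornerX mulrC.
exists ('X * dlaurent p); first by rewrite mulf_neq0 ?polyX_eq0 ?dlaurent_neq0.
move=> x x0; rewrite iterS /recip_derive /laurent_exp hornerM hornerX -mulrA.
congr (_ * _); rewrite derive1E.
rewrite (@near_eq_derive _ _ _ _ (laurent_exp p)).
  by have [_ ->] := is_derive_laurent_exp p x0.
by apply: filterS (near_neq0 x0) => y /IH.
Qed.

End Laurent.

Theorem proposition4 (R : realType) (n : nat) (c0 : R) (p : {poly int})
    (hp : strict_laurent p)
    (hk : forall x : R, x != 0 ->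
      bessel_k n x = laurent_eval p x * expR (- x)) :
  [set x : R | x != 0 /\ laurent_eval p x * expR (- x) = c0] =
  [set inverse_branch (@nonzero_reals R) (bessel_k n) b c0 |
     b in branch_numbers_of (@nonzero_reals R) (bessel_k n) c0].
Proof.
pose q : {poly R} := map_poly intr p.
have fE (x : R) : x != 0 -> bessel_k n x = laurent_exp q x := hk x.
have q0 : q != 0.
  have [P P0 PE] := iter_recip_derive R n.
  apply: contraNneq P0 => q0; apply/eqP/laurent_exp_eq0 => x x0.
  apply: (mulfI (expf_neq0 n (_ : - x != 0))); first by rewrite oppr_eq0.
  by rewrite -PE// -/(bessel_k n x) fE// q0 /laurent_exp horner0 mul0r mulr0.
have [rts rtsP] := finitely_many_roots (dlaurent_neq0 q0).
pose Z := 0 :: map GRing.inv rts.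
have cont (x : R) : nonzero_reals x -> {for x, continuous (@bessel_k R n)}.
  move=> x0; rewrite /prop_for /continuous_at fE//.
  apply: cvg_trans (continuous_laurent_exp (p := q) x0).
  apply: near_eq_cvg; apply: filterS (near_neq0 x0) => y y0.
  by rewrite fE.
have gaps (a b : R) : a < b -> misses Z a b ->
    monotone_on (bessel_k n) (`]a, b[) /\
    {in (`]a, b[) &, injective (@bessel_k R n)}.
  move=> ab Zab.
  have E x : x \in `]a, b[ -> bessel_k n x = laurent_exp q x.
    move=> xab; apply: fE; apply: contraPneq (xab) => ->; rewrite in_itv/=.
    by apply: Zab; rewrite mem_head.
  have rZ x : x != 0 -> root (dlaurent q) x^-1 -> x \in map GRing.inv rts.
    by move=> _ /rtsP rx; rewrite -[x]invrK map_f.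
  have [m i] := laurent_exp_gap_mono ab rZ Zab.
  split; last by move=> x y xab yab; rewrite !E//; exact: i.
  by case: m => m; [left|right] => x y xab yab xy; rewrite !E ?m//;
    move: xab yab => /set_mem + /set_mem.
rewrite -(solutions_by_branches (Z := Z) _ cont gaps).
  by apply/seteqP; split => x [x0 <-]; split => //=; rewrite hk.
by move=> x; rewrite inE negb_or => /andP[].
Qed.
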